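(* Let $k(t,s)=\sum_{i=0}^\infty\sum_{j=0}^\infty t^is^jK_{ij}$ (with $K_{ij}$ real $N\times N$ matrices), $\xi(t)=\sum_{i=0}^\infty t^i\Xi_i$ and $x(t)=\sum_{i=0}^\infty t^iX_i$ (with $\Xi_i,X_i\in\mathbb{R}^N$) be power series that converge absolutely for $|t|,|s|<\rho$ for some $\rho>0$, and set $$\mathbf{K}_{nj}:=\sum_{i=0}^{j}\frac{1}{n-i+1}K_{i,j-i},\qquad 0\le j\le n.$$ Suppose that $j_0\ge0$ is an integer such that $\mathbf{K}_{nj}=0$ for all $n\ge 0$ and all $j$ with $0\le j<j_0$, $j\le n$, and such that $\mathbf{K}_{nj_0}$ is nonsingular for all $n\ge j_0$. If $x$ satisfies the first-kind Volterra system $$\xi(t)+\int_0^tk(t,s)x(s)\,ds=0$$ for all sufficiently small $t\ge0$, then $\Xi_0=0$, $\Xi_{n+1}=0$ for all $n$ with $0\le n\le j_0-1$, and for all $n\ge j_0$ $$X_{n-j_0}=-\mathbf{K}_{nj_0}^{-1}\Big[\Xi_{n+1}+\sum_{j=j_0+1}^{n}\mathbf{K}_{nj}X_{n-j}\Big].$$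
   Context: Sums over empty index sets are $0$. *)

(* Defs.v *)
From HB Require Import structures.
From mathcomp Require Import all_boot all_order all_algebra.
From mathcomp Require Import all_classical all_reals all_analysis.

Set Implicit Arguments.
Unset Strict Implicit.
Unset Printing Implicit Defensive.

Import Order.TTheory GRing.Theory Num.Theory.
Import numFieldNormedType.Exports.

Local Open Scope classical_set_scope.
Local Open Scope ring_scope.

(* Power series with coefficients in a normed module; below, V is a space of
   matrices or column vectors with its canonical (max) norm. *)

Definition powser (R : realType) (V : normedModType R) (c : nat -> V)
    (t : R) : V :=
  limn (series (fun i => t ^+ i *: c i)).

Definition powser_abs_cvg (R : realType) (V : normedModType R) (c : nat -> V)
    (t : R) : Prop :=
  cvgn [normed series (fun i => t ^+ i *: c i)].

Definition powser2 (R : realType) (V : normedModType R) (c : nat -> nat -> V)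
    (t s : R) : V :=
  limn (series (fun i => limn (series (fun j => (t ^+ i * s ^+ j) *: c i j)))).

(* The double family of norms has a finite (unordered) sum. *)
Definition powser2_abs_cvg (R : realType) (V : normedModType R)
    (c : nat -> nat -> V) (t s : R) : Prop :=
  summable [set: nat * nat]
    (fun ij => (`|(t ^+ ij.1 * s ^+ ij.2) *: c ij.1 ij.2|)%:E).

(* int_0^t f(s) ds, taken componentwise; only used for 0 <= t. *)
Definition vint (R : realType) (N : nat) (f : R -> 'cV[R]_N) (t : R) :
    'cV[R]_N :=
  \col_a Rintegral lebesgue_measure `[0, t] (fun s => f s a 0).

(* The subtraction n - i is only meaningful for i <= j <= n. *)
Definition bK (R : realType) (N : nat) (K : nat -> nat -> 'M[R]_N)
    (n j : nat) : 'M[R]_N :=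
  \sum_(0 <= i < j.+1) ((n - i).+1%:R)^-1 *: K i (j - i)%N.

(* Main.v *)
(* Comparing coefficients of t^(n+1) in the equation gives
   Xi_(n+1) + sum_(m <= n) bK n m X_(n-m) = 0, and the recursion is this
   triangular system solved for X_(n-j0). To avoid multiplying and integrating
   infinite series, all series are truncated at order M: for 0 <= s <= t the
   error is O((t/r)^M) uniformly in s, since the series converge absolutely at a
   fixed r > t. Hence a polynomial in t carrying the right coefficients below
   order M is O(t^M) near 0+, so those coefficients vanish. The same uniform
   estimate shows that the integrand is a limit of polynomials in s, hence
   measurable. *)

Require Import Defs.
From HB Require Import structures.
From mathcomp Require Import all_boot all_order all_algebra.
From mathcomp Require Import all_classical all_reals all_analysis.
From mathcomp Require Import ring lra zify.

Set Implicit Arguments.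
Unset Strict Implicit.
Unset Printing Implicit Defensive.

Import Order.TTheory GRing.Theory Num.Theory.
Import numFieldNormedType.Exports.

Local Open Scope classical_set_scope.
Local Open Scope ring_scope.

(** * Truncation errors of simple and double power series *)

Lemma norm_limn_sub_le (R : realType) (V : normedModType R) (u : nat -> V)
    (v : V) (B : R) :
  cvgn u -> (\forall n \near \oo, `|u n - v| <= B) -> `|limn u - v| <= B.
Proof.
move=> cu uB.
have cN : (fun n => `|u n - v|) @ \oo --> `|limn u - v|.
  by apply: cvg_norm; apply: cvgB => //; exact: cvg_cst.
rewrite -(cvg_lim (@Rhausdorff R) cN); apply: limr_le => //.
by apply/cvg_ex; eexists; exact: cN.
Qed.

(** Each term is at most [(q / r) ^+ i] times [r ^+ i * |c i|], and beyond index [M] the first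
    factor is at most [(q / r) ^+ M]. The bound depends on [q] only, so it is uniform in [s]; the
    case [M = 0] bounds the series itself by [A]. *)
Lemma powser_tail (R : realType) (V : completeNormedModType R) (c : nat -> V)
    (r A q s : R) (M : nat) :
  0 < r -> (forall n, \sum_(0 <= i < n) r ^+ i * `|c i| <= A) ->
  `|s| <= q -> q <= r ->
  cvgn (series (fun i => s ^+ i *: c i)) /\
  `|powser c s - \sum_(0 <= i < M) s ^+ i *: c i| <= A * (q / r) ^+ M.
Proof.
move=> r0 hA sq qr.
have q0 : 0 <= q := le_trans (normr_ge0 s) sq.
have qr1 : q / r <= 1 by rewrite ler_pdivrMr// mul1r.
have qr0 : 0 <= q / r by rewrite divr_ge0// ltW.
have term i : `|s ^+ i *: c i| <= (q / r) ^+ i * (r ^+ i * `|c i|).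
  rewrite normrZ normrX mulrA -exprMn divfK ?gt_eqF//.
  by apply: ler_wpM2r => //; rewrite lerXn2r// nnegrE.
have rc0 i : 0 <= r ^+ i * `|c i| by rewrite mulr_ge0// exprn_ge0// ltW.
have cS : cvgn (series (fun i => s ^+ i *: c i)).
  apply: normed_cvg; apply: nondecreasing_is_cvgn.
    by apply: nondecreasing_series => i _ _; exact: normr_ge0.
  exists A => _ [n _ <-]; apply: le_trans (hA n).
  apply: ler_sum => i _; apply: le_trans (term i) _.
  by rewrite ler_piMl// exprn_ile1.
split=> //; apply: norm_limn_sub_le => //.
exists M => // n /= Mn.
rewrite -[X in _ - X]/(series (fun i => s ^+ i *: c i) M) sub_series_geq//.
apply: le_trans (ler_norm_sum _ _ _) _.
apply: (@le_trans _ _ (\sum_(M <= i < n) (q / r) ^+ M * (r ^+ i * `|c i|))).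
  rewrite big_nat_cond [leRHS]big_nat_cond.
  apply: ler_sum => i /andP[/andP[Mi _] _]; apply: le_trans (term i) _.
  by apply: ler_wpM2r => //; exact: ler_wiXn2l.
rewrite -mulr_sumr mulrC ler_wpM2r ?exprn_ge0//.
apply: le_trans (hA n); rewrite [leRHS](big_cat_nat _ Mn)//= lerDr.
exact: sumr_ge0.
Qed.

(** The double series is a series in [t] whose coefficients are the row sums [u i], so the simple
    estimate applies twice: cutting the outer series costs [A * (q / r) ^+ M], and cutting all
    remaining rows costs as much again. Hence the factor 2. *)
Lemma powser2_tail (R : realType) (V : completeNormedModType R)
    (c : nat -> nat -> V) (r A q t s : R) (M : nat) :
  0 < r ->
  (forall n m, \sum_(0 <= i < n) \sum_(0 <= j < m) r ^+ (i + j) * `|c i j|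
     <= A) ->
  `|t| <= q -> `|s| <= q -> q <= r ->
  `|powser2 c t s -
    \sum_(0 <= i < M) \sum_(0 <= j < M) (t ^+ i * s ^+ j) *: c i j|
    <= 2 * A * (q / r) ^+ M.
Proof.
move=> r0 hA tq sq qr.
pose S i m := \sum_(0 <= j < m) r ^+ j * `|c i j|.
pose B i := limn (S i).
have hS n m : \sum_(0 <= i < n) r ^+ i * S i m <= A.
  apply: le_trans (hA n m); apply: ler_sum => i _; rewrite /S mulr_sumr.
  by apply: ler_sum => j _; rewrite exprD mulrA.
have S0 i m : 0 <= S i m.
  by apply: sumr_ge0 => j _; rewrite mulr_ge0// exprn_ge0// ltW.
have r0n i : 0 <= r ^+ i by rewrite exprn_ge0// ltW.
have ndS i : {homo S i : n m / (n <= m)%N >-> n <= m}.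
  by apply: nondecreasing_series => j _ _; rewrite mulr_ge0.
have cvS i : cvgn (S i).
  apply: nondecreasing_is_cvgn => //; exists (A / r ^+ i) => _ [m _ <-].
  rewrite ler_pdivlMr ?exprn_gt0// mulrC; apply: le_trans (hS i.+1 m).
  by rewrite big_nat_recr//= lerDr; apply: sumr_ge0 => k _; exact: mulr_ge0.
have hB i m : S i m <= B i by exact: nondecreasing_cvgn_le.
(* The row bounds [B i] inherit the bound [A] by letting the row length tend to infinity while the
   number [n] of rows stays fixed. *)
have hBA n : \sum_(0 <= i < n) r ^+ i * B i <= A.
  have cB : (fun m => \sum_(0 <= i < n) r ^+ i * S i m) @ \oo -->
      \sum_(0 <= i < n) r ^+ i * B i.
    elim: n => [|n IH].
      by rewrite big_geq//; under eq_fun do rewrite big_geq//; exact: cvg_cst.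
    rewrite big_nat_recr//=; under eq_fun do rewrite big_nat_recr//=.
    by apply: cvgD => //; apply: cvgM; [exact: cvg_cst|exact: cvS].
  rewrite -(cvg_lim (@Rhausdorff R) cB); apply: limr_le.
    by apply/cvg_ex; eexists; exact: cB.
  by exists 0%N.
pose u i := powser (c i) s.
have [cu hu] : (forall i, cvgn (series (fun j => s ^+ j *: c i j))) /\
    (forall i m, `|u i - \sum_(0 <= j < m) s ^+ j *: c i j|
      <= B i * (q / r) ^+ m).
  by split=> [i|i m]; [have := powser_tail 0 r0 (hB i) sq qr|
     have := powser_tail m r0 (hB i) sq qr] => -[].
have uB i : `|u i| <= B i.
  by have := hu i 0%N; rewrite big_geq// subr0 expr0 mulr1.
have hrA n : \sum_(0 <= i < n) r ^+ i * `|u i| <= A.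
  by apply: le_trans (hBA n); apply: ler_sum => i _; exact: ler_wpM2l.
have -> : powser2 c t s = powser u t.
  rewrite /powser2 /powser; congr (limn (series _)); apply/funext => i.
  rewrite /u /powser -limZr//; congr (limn _); apply/funext => m.
  rewrite /series/= [RHS]scaler_sumr.
  by apply: eq_bigr => j _; rewrite scalerA.
have [_ h1] := powser_tail M r0 hrA tq qr.
set P := \sum_(0 <= i < M) t ^+ i *: u i in h1.
set Q := (X in `|_ - X|).
(* [P] is truncated in [i] only, [Q] in both indices. Row [i] contributes at most
   [r ^+ i * B i * (q / r) ^+ M], and [hBA] sums these. *)
have h2 : `|P - Q| <= A * (q / r) ^+ M.
  rewrite /P /Q -sumrB; apply: le_trans (ler_norm_sum _ _ _) _.
  have q0 : 0 <= q := le_trans (normr_ge0 s) sq.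
  have qrM : 0 <= (q / r) ^+ M by rewrite exprn_ge0// divr_ge0// ltW.
  apply: le_trans (ler_wpM2r qrM (hBA M)); rewrite mulr_suml.
  apply: ler_sum => i _.
  have -> : t ^+ i *: u i - \sum_(0 <= j < M) (t ^+ i * s ^+ j) *: c i j =
      t ^+ i *: (u i - \sum_(0 <= j < M) s ^+ j *: c i j).
    rewrite scalerBr; congr (_ - _); rewrite scaler_sumr.
    by apply: eq_bigr => j _; rewrite scalerA.
  rewrite normrZ normrX -mulrA; apply: ler_pM => //.
  by apply: lerXn2r; rewrite ?nnegrE// ?(le_trans tq)// ltW.
have -> : powser u t - Q = (powser u t - P) + (P - Q) by rewrite addrA subrK.
apply: le_trans (ler_normD _ _) _; rewrite -mulrA mulr_natl mulr2n.
exact: lerD.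
Qed.

(** * Polynomials that are small near 0, and integrals approximated by polynomials *)

Lemma poly_coef_eq0_of_bound (R : realType) (p : {poly R}) (M : nat) (d C : R) :
  0 < d -> (forall t, 0 < t -> t < d -> `|p.[t]| <= C * t ^+ M) ->
  forall i, (i < M)%N -> p`_i = 0.
Proof.
move=> d0; elim: M p => [//|M IH] p hp.
(* The bound squeezes [p] to 0 at [0^'+], and continuity identifies this limit with [p.[0]]. Then
   [p = q * 'X], and dividing by [t > 0] gives [q] the same bound with exponent [M] and the same
   [C]. *)
have p0 : p.[0] = 0.
  have cp : (horner p) x @[x --> 0^'+] --> p.[0].
    by apply: cvg_at_right_filter; exact: continuous_horner.
  have cC : (fun x : R => C * x ^+ M.+1) x @[x --> 0^'+] --> (0 : R).
    rewrite -[X in _ --> X](_ : C * 0 ^+ M.+1 = 0); last first.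
      by rewrite expr0n/= mulr0.
    apply: cvg_at_right_filter; apply: cvgM; first exact: cvg_cst.
    exact: exprn_continuous.
  apply: (cvg_unique _ cp) => //.
  apply/norm_cvg0P; apply: (squeeze_cvgr _ (cvg_cst 0) cC).
  near=> x; rewrite normr_ge0/=; apply: hp; first by near: x; exact: nbhs_right_gt.
  by near: x; exact: nbhs_right_lt.
have /factor_theorem[q pq] : root p 0 by apply/rootP.
rewrite subr0 in pq.
have hq : forall i, (i < M)%N -> q`_i = 0.
  apply: IH => t t0 td; have := hp t t0 td.
  rewrite pq hornerM hornerX normrM (gtr0_norm t0) exprSr mulrA.
  by rewrite ler_pM2r.
by case=> [|i] iM; rewrite pq coefMX//=; exact: hq.
Unshelve. all: by end_near.
Qed.

Lemma Rintegral_horner (R : realType) (p q : {poly R}) (t : R) :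
  0 <= t -> q^`() = p -> 
  \int[lebesgue_measure]_(s in `[0, t]) p.[s] = q.[t] - q.[0].
Proof.
rewrite le_eqVlt => /predU1P[<- _|t0 qp].
  by rewrite set_itv1 Rintegral_set1 subrr.
rewrite /Rintegral (@continuous_FTC2 _ _ (horner q))//.
- by apply: continuous_in_subspaceT => x _; exact: continuous_horner.
- split=> [x _||]; first exact: derivable_horner.
    by apply: cvg_at_right_filter; exact: continuous_horner.
  by apply: cvg_at_left_filter; exact: continuous_horner.
- move=> x _; rewrite derive1E -qp.
  exact: (@derive_val _ _ _ _ _ _ _ (is_derive_poly q x)).
Qed.

(** The whole sequence [P] serves to make [f] measurable, as a pointwise limit of polynomials; the
    estimate itself compares [f] with the single polynomial [P M] on an interval of length [t]. *)
Lemma Rintegral_approx (R : realType) (f : R -> R) (P : nat -> {poly R})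
    (t C e : R) (M : nat) :
  0 <= t -> 0 <= e < 1 ->
  (forall n s, 0 <= s <= t -> `|f s - (P n).[s]| <= C * e ^+ n) ->
  `|\int[lebesgue_measure]_(s in `[0, t]) f s -
    \int[lebesgue_measure]_(s in `[0, t]) (P M).[s]| <= t * (C * e ^+ M).
Proof.
move=> t0 /andP[e0 e1] hf.
have mt : measurable (`[0, t]%classic : set (measurableTypeR R)) by exact: measurable_itv.
have mut : lebesgue_measure (`[0, t]%classic : set (measurableTypeR R)) = t%:E.
  rewrite lebesgue_measure_itv/= lte_fin sube0.
  by case: ltgtP t0 => // <-.
have mf : measurable_fun (`[0, t]%classic : set (measurableTypeR R)) f.
  apply: (@measurable_realfun.measurable_fun_cvg _ _ _ _ (fun n => horner (P n))).
    by move=> n; exact: measurable_poly.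
  move=> s /=; rewrite in_itv/= => hs.
  apply/subr_cvg0/norm_cvg0P.
  have cC : (fun n => C * e ^+ n) @ \oo --> (0 : R).
    rewrite -[X in _ --> X](mulr0 C); apply: cvgM; first exact: cvg_cst.
    by apply: cvg_expr; rewrite ger0_norm.
  apply: (squeeze_cvgr _ (cvg_cst 0) cC).
  by apply: nearW => n; rewrite normr_ge0/= distrC hf.
have iP n : lebesgue_measure.-integrable `[0, t] (EFin \o horner (P n)).
  apply: continuous_compact_integrable; first exact: segment_compact.
  by apply: continuous_in_subspaceT => x _; exact: continuous_horner.
have iB n : lebesgue_measure.-integrable `[0, t] (EFin \o (fun s => f s - (P n).[s])).
  apply: measurable_bounded_integrable => //.
  - by have := ltry t; rewrite -mut.
  - by apply: measurable_realfun.measurable_funB => //; exact: measurable_poly.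
  - exists (C * e ^+ n); split; first exact: num_real.
    move=> B hB s /=; rewrite in_itv/= => hs.
    exact: le_trans (hf n s hs) (ltW hB).
(* [f] is the sum of the bounded error [f - P M] and the continuous [P M]. *)
have if_ : lebesgue_measure.-integrable `[0, t] (EFin \o f).
  have := integrableD mt (iB M) (iP M); apply: eq_integrable => // s _ /=.
  by rewrite -EFinD subrK.
rewrite -RintegralB//.
apply: le_trans (le_normr_Rintegral mt (iB M)) _.
have -> : t * (C * e ^+ M) = \int[lebesgue_measure]_(s in `[0, t]) (C * e ^+ M).
  rewrite Rintegral_cst// mulrC; congr (_ * _); by rewrite -[LHS]/(fine t%:E) -mut.
apply: le_Rintegral => //.
- by have := integrable_norm (iB M); apply: eq_integrable.
- apply: continuous_compact_integrable; first exact: segment_compact.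
  by apply: continuous_in_subspaceT => x _; exact: cvg_cst.
- by move=> s /=; rewrite in_itv/= => hs; exact: hf.
Qed.

(** * Bounds on entries and on partial sums *)

Lemma mx_entry_norm_le (R : realType) (m n : nat) (A : 'M[R]_(m, n)) i j :
  `|A i j| <= `|A|.
Proof.
rewrite [leRHS]/Num.Def.normr/= mx_normrE.
exact: (le_bigmax 0 (fun ij => `|A ij.1 ij.2|) (i, j)).
Qed.

Lemma summable_rect_bound (R : realType) (V : normedModType R)
    (c : nat -> nat -> V) (r : R) :
  0 <= r -> powser2_abs_cvg c r r ->
  exists A, forall n m,
    \sum_(0 <= i < n) \sum_(0 <= j < m) r ^+ (i + j) * `|c i j| <= A.
Proof.
move=> r0; rewrite /powser2_abs_cvg => sc.
move: sc; rewrite summableE; set e := esum _ _ => fe.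
exists (fine e) => n m.
rewrite -lee_fin fineK//; apply: esum_ge.
pose s := [seq (i, j) | i <- index_iota 0 n, j <- index_iota 0 m].
(* A rectangle of indices is one of the finite sets over which [esum] takes its supremum. *)
exists [set` s]; first by split=> //; exact: finite_seq.
have us : uniq s by rewrite allpairs_uniq ?iota_uniq// => -[? ?] [? ?].
rewrite -fsbig_seq// big_allpairs_dep/= -sumEFin; apply: lee_sum => i _.
rewrite -sumEFin; apply: lee_sum => j _.
by rewrite lee_fin normr_id normrZ ger0_norm ?exprD ?mulr_ge0 ?exprn_ge0.
Qed.

Lemma powser_abs_cvg_bound (R : realType) (V : normedModType R)
    (c : nat -> V) (r : R) :
  0 <= r -> powser_abs_cvg c r ->
  exists A, forall n, \sum_(0 <= i < n) r ^+ i * `|c i| <= A.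
Proof.
move=> r0 cc; exists (limn [normed series (fun i => r ^+ i *: c i)]) => n.
apply: le_trans (nondecreasing_cvgn_le _ cc n).
  apply: ler_sum => i _.
  by rewrite /= normrZ ger0_norm// exprn_ge0.
by apply: (@nondecreasing_series _ _ xpredT 0%N) => i _ _; exact: normr_ge0.
Qed.

(** The weight [1 / (j + l + 1)] comes from integrating [s ^+ (j + l)]. On [i + j + l = n] it equals
    [1 / (n - i + 1)], so grouping the terms by [m = i + j] produces [bK K n m]. Since [n < M], the
    truncation loses no such triple. *)
Lemma sum_conv_bK (R : realType) (N : nat) (K : nat -> nat -> 'M[R]_N)
    (X : nat -> 'cV[R]_N) (n M : nat) : (n < M)%N ->
  \sum_(0 <= i < M) \sum_(0 <= j < M) \sum_(0 <= l < M)
     (if (i + j + l == n)%N then ((j + l).+1%:R)^-1 else 0) *: (K i j *m X l)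
  = \sum_(0 <= m < n.+1) bK K n m *m X (n - m)%N.
Proof.
move=> nM.
pose g i j := ((n - i).+1%:R)^-1 *: (K i j *m X (n - (i + j))%N).
(* For given [i] and [j] only [l = n - (i + j)] survives. The guarded sum over [m] has one term if
   [i + j <= n] and none otherwise. *)
transitivity (\sum_(0 <= i < M) \sum_(0 <= j < M)
    \sum_(0 <= m < n.+1 | m == (i + j)%N) g i j).
  apply: eq_bigr => i _; apply: eq_bigr => j _.
  rewrite (big_nat1_eq _ (fun=> g i j)) ltnS/=.
  have [ijn|nij] := leqP (i + j) n; last first.
    by apply: big1 => l _; case: eqP => [|_]; [lia|rewrite scale0r].
  rewrite (eq_bigr (fun l => if l == (n - (i + j))%N then g i j else 0)).
    by rewrite -big_mkcond (big_nat1_eq _ (fun=> g i j)) (leq_ltn_trans _ nM)// leq_subr.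
  move=> l _; case: (l =P _) => [->|ln].
    by rewrite subnKC// eqxx /g; congr ((_%:R)^-1 *: _); lia.
  by case: eqP => [|_]; [lia|rewrite scale0r].
transitivity (\sum_(0 <= m < n.+1) \sum_(0 <= i < M) \sum_(0 <= j < M)
    if m == (i + j)%N then g i j else 0).
  rewrite [RHS]exchange_big/=. apply: eq_bigr => i _.
  rewrite [RHS]exchange_big/=; apply: eq_bigr => j _.
  exact: big_mkcond.
apply: eq_big_nat => m; rewrite /= ltnS => mn.
rewrite /bK mulmx_suml (big_nat_widen 0 m.+1 M) ?ltnS ?(leq_ltn_trans mn nM)//.
rewrite [RHS]big_mkcond/=; apply: eq_bigr => i _; rewrite ltnS.
case: leqP => [im|mi]; last first.
  by rewrite big1// => j _; case: eqP => //; lia.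
rewrite -big_mkcond (eq_bigl (fun j => j == (m - i)%N)); last by move=> j; lia.
rewrite (big_nat1_eq _ (fun j => g i j)).
rewrite (leq_ltn_trans (leq_subr _ _)) ?(leq_ltn_trans _ nM)//.
by rewrite -scalemxAl /g subnKC.
Qed.


(* HB does not infer this join, although both structures are instances. *)
Definition matrix_completeNormedModType (R : realType) m n : completeNormedModType R :=
  HB.pack 'M[R]_(m,n) (Complete.on 'M[R]_(m,n)) (NormedModule.on 'M[R]_(m,n)).

(** The max norm is not submultiplicative; the factor [n] counts the products in one entry. *)
Lemma mulmx_entry_norm_le (R : realType) (m n p : nat) (A : 'M[R]_(m, n))
    (B : 'M[R]_(n, p)) i j :
  `|(A *m B) i j| <= n%:R * (`|A| * `|B|).
Proof.
rewrite mxE; apply: le_trans (ler_norm_sum _ _ _) _.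
rewrite [leRHS](_ : _ = \sum_(k < n) `|A| * `|B|); last first.
  by rewrite sumr_const card_ord mulr_natl.
apply: ler_sum => k _.
by rewrite normrM ler_pM// mx_entry_norm_le.
Qed.

(** * Comparison of coefficients in the integral equation *)

Lemma volterra_coef (R : realType) (N : nat)
    (K : nat -> nat -> 'M[R]_N) (Xi X : nat -> 'cV[R]_N)
    (rho : R) (rho_gt0 : 0 < rho)
    (K_cvg : forall t s : R, `|t| < rho -> `|s| < rho -> powser2_abs_cvg K t s)
    (Xi_cvg : forall t : R, `|t| < rho -> powser_abs_cvg Xi t)
    (X_cvg : forall t : R, `|t| < rho -> powser_abs_cvg X t)
    (volterra : exists2 delta : R, 0 < delta &
      forall t : R, 0 <= t -> t < delta ->
        powser Xi t + vint (fun s => powser2 K t s *m powser X s) t = 0) :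
  Xi 0%N = 0 /\ forall n, 
    Xi n.+1 + \sum_(0 <= m < n.+1) bK K n m *m X (n - m)%N = 0.
Proof.
pose r := rho / 2.
have r0 : 0 < r by rewrite divr_gt0.
have rN : `|r| < rho by rewrite gtr0_norm// /r; lra.
have [A hA] := summable_rect_bound (ltW r0) (K_cvg r r rN rN).
have [B hB] := powser_abs_cvg_bound (ltW r0) (X_cvg r rN).
have [D hD] := powser_abs_cvg_bound (ltW r0) (Xi_cvg r rN).
have [delta d0 hv] := volterra.
pose y a i j l := (K i j *m X l) a 0.
(* Component [a] of the left-hand side with all series cut at [M] and the integral taken term by
   term. *)
pose p a M : {poly R} := \sum_(0 <= i < M) (Xi i a 0) *: 'X^i +
  \sum_(0 <= i < M) \sum_(0 <= j < M) \sum_(0 <= l < M)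
    (y a i j l / (j + l).+1%:R) *: 'X^((i + j + l).+1).
have A0 : 0 <= A by have := hA 0%N 0%N; rewrite big_geq.
have B0 : 0 <= B by have := hB 0%N; rewrite big_geq.
(* [N] comes from the matrix product, [2 * A * B] from the kernel times the tail of [x], and
   [2 * A * (2 * B)] from the tail of the kernel times the truncated [x]. *)
pose C := N%:R * (2 * A * B + 2 * A * (2 * B)).
have pbound a M t : 0 < t -> t < Num.min delta r ->
    `|(p a M).[t]| <= (D + r * C) / r ^+ M * t ^+ M.
  move=> t0; rewrite lt_min => /andP[td tr].
  have t0' := ltW t0; have tr' := ltW tr; have tn : `|t| <= t by rewrite gtr0_norm.
  (* For fixed [t], [P n] is the truncated integrand as a polynomial in [s], and [Q n] is its
     antiderivative vanishing at 0. *)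
  pose P n : {poly R} := \sum_(0 <= i < n) \sum_(0 <= j < n) \sum_(0 <= l < n)
    (t ^+ i * y a i j l) *: 'X^(j + l).
  pose Q n : {poly R} := \sum_(0 <= i < n) \sum_(0 <= j < n) \sum_(0 <= l < n)
    (t ^+ i * y a i j l / (j + l).+1%:R) *: 'X^((j + l).+1).
  have entryB (U V : 'cV[R]_N) : (U - V) a 0 = U a 0 - V a 0 by rewrite !mxE.
  pose f s := (powser2 K t s *m powser X s) a 0.
  have fP n s : 0 <= s <= t -> `|f s - (P n).[s]| <= C * (t / r) ^+ n.
    move=> /andP[s0 st].
    have sn : `|s| <= t by rewrite ger0_norm.
    pose k n := \sum_(0 <= i < n) \sum_(0 <= j < n) (t ^+ i * s ^+ j) *: K i j.
    pose x n := \sum_(0 <= l < n) s ^+ l *: X l.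
    have hk m : `|powser2 K t s - k m| <= 2 * A * (t / r) ^+ m.
      exact: (@powser2_tail _ (matrix_completeNormedModType R N N) K r A t t s m).
    have hx m : `|powser X s - x m| <= B * (t / r) ^+ m.
      by have [] := @powser_tail _ (matrix_completeNormedModType R N 1) X r B t s m r0 hB sn tr'.
    have hk0 : `|powser2 K t s| <= 2 * A.
      by have := hk 0%N; rewrite /k big_geq// subr0 expr0 mulr1.
    have hx0 : `|powser X s| <= B.
      by have := hx 0%N; rewrite /x big_geq// subr0 expr0 mulr1.
    have e0 : 0 <= (t / r) ^+ n by rewrite exprn_ge0// divr_ge0// ltW.
    have e1 : (t / r) ^+ n <= 1.
      apply: exprn_ile1; first by rewrite divr_ge0// ltW.
      by rewrite ler_pdivrMr// mul1r.
    have hxn : `|x n| <= 2 * B.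
      rewrite -[x n](subKr (powser X s)); apply: le_trans (ler_normB _ _) _.
      rewrite mulr_natl mulr2n lerD//; apply: le_trans (hx n) _.
      by rewrite ler_piMr.
    have -> : (P n).[s] = (k n *m x n) a 0.
      rewrite /P /k /x mulmx_suml summxE horner_sum; apply: eq_bigr => i _.
      rewrite mulmx_suml summxE horner_sum; apply: eq_bigr => j _.
      rewrite mulmx_sumr summxE horner_sum; apply: eq_bigr => l _.
      rewrite hornerZ hornerXn -scalemxAl -scalemxAr 2![in RHS]mxE.
      by rewrite -/(y a i j l) exprD; ring.
    (* The error of a product is split as [k x - k_n x_n = k (x - x_n) + (k - k_n) x_n]. *)
    have -> : f s - (k n *m x n) a 0 =
        (powser2 K t s *m (powser X s - x n)) a 0 +
        ((powser2 K t s - k n) *m x n) a 0.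
      by rewrite mulmxBr mulmxBl !entryB addrA subrK.
    apply: le_trans (ler_normD _ _) _; rewrite /C -mulrA mulrDl mulrDr.
    apply: lerD; apply: le_trans (mulmx_entry_norm_le _ _ _ _) _;
      apply: ler_wpM2l => //.
      by rewrite -mulrA; apply: ler_pM.
    by rewrite mulrAC; apply: ler_pM.
  have e01 : 0 <= t / r < 1.
    by rewrite divr_ge0 ?(ltW r0)// ltr_pdivrMr// mul1r.
  have := Rintegral_approx M t0' e01 fP.
  have QP : (Q M)^`() = P M.
    rewrite /P /Q raddf_sum; apply: eq_bigr => i _.
    rewrite raddf_sum; apply: eq_bigr => j _.
    rewrite raddf_sum; apply: eq_bigr => l _ /=.
    by rewrite derivZ derivXn /= -(scaler_nat _ 'X^(j + l)) scalerA divfK// pnatr_eq0.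
  rewrite (Rintegral_horner t0' QP).
  have -> : (Q M).[0] = 0.
    rewrite /Q horner_sum big1// => i _; rewrite horner_sum big1// => j _.
    by rewrite horner_sum big1// => l _; rewrite hornerZ hornerXn expr0n mulr0.
  rewrite subr0 => hint.
  have hXi : `|powser Xi t - \sum_(0 <= i < M) t ^+ i *: Xi i| <= D * (t / r) ^+ M.
    by have [] := @powser_tail _ (matrix_completeNormedModType R N 1) Xi r D t t M r0 hD tn tr'.
  have hXia := le_trans (mx_entry_norm_le _ a 0) hXi.
  rewrite entryB in hXia.
  have := congr1 (fun v : 'cV_N => v a 0) (hv t t0' td); rewrite !mxE => ev.
  (* The exact left-hand side is 0 by [ev], so [p a M] at [t] is minus the sum of the two truncation
     errors. *)
  have -> : (p a M).[t] = - ((powser Xi t a 0 - (\sum_(0 <= i < M) t ^+ i *: Xi i) a 0) +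
     (\int[lebesgue_measure]_(s in `[0, t]) f s - (Q M).[t])).
    rewrite addrACA -opprD ev sub0r opprK /p hornerD summxE horner_sum.
    congr (_ + _); first by apply: eq_bigr => i _; rewrite hornerZ hornerXn mxE mulrC.
    rewrite /Q !horner_sum; apply: eq_bigr => i _.
    rewrite !horner_sum; apply: eq_bigr => j _.
    rewrite !horner_sum; apply: eq_bigr => l _.
    rewrite !hornerZ !hornerXn -[(i + j + l).+1]addnS -addnA addnS exprD; ring.
  rewrite normrN; apply: le_trans (ler_normD _ _) _.
  apply: le_trans (lerD hXia hint) _.
  (* The length [t] of the interval is then bounded by [r], which gives the term [r * C]. *)
  rewrite [leRHS](_ : _ = D * (t / r) ^+ M + r * (C * (t / r) ^+ M)); last first.
    by rewrite (expr_div_n t r M) -mulrA [_^-1 * _]mulrC mulrDl !mulrA.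
  rewrite lerD2l ler_wpM2r// mulr_ge0//; last by case/andP: e01 => ? _; exact: exprn_ge0.
  by rewrite /C !(mulr_ge0, addr_ge0).
have pcoef a M i : (i < M)%N -> (p a M)`_i = 0.
  by move=> iM; apply: (poly_coef_eq0_of_bound _ (pbound a M) iM); rewrite lt_min d0 r0.
split=> [|n].
  (* The order of truncation is chosen just above the coefficient wanted: 1 here, [n.+2] for
     coefficient [n.+1]. Integrated terms have positive degree, so only [Xi 0] enters the constant
     one. *)
  apply/colP => a; rewrite mxE -(pcoef a 1%N 0%N)// /p coefD !big_nat1.
  by rewrite !coefZ !coefXn mulr1 mulr0 addr0.
apply/colP => a; rewrite [RHS]mxE -(pcoef a n.+2 n.+1)// /p coefD mxE.
congr (_ + _).
  rewrite coef_sum (eq_bigr (fun i => if i == n.+1 then Xi i a 0 else 0)).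
    by rewrite -big_mkcond big_nat1_eq /= ltnSn.
  by move=> i _; rewrite coefZ coefXn eq_sym; case: eqP; rewrite (mulr1, mulr0).
rewrite -(@sum_conv_bK _ _ _ _ _ n.+2)// summxE coef_sum; apply: eq_bigr => i _.
rewrite summxE coef_sum; apply: eq_bigr => j _.
rewrite summxE coef_sum; apply: eq_bigr => l _.
rewrite coefZ coefXn eqSS eq_sym mxE /y; case: eqP => _; last by rewrite mul0r mulr0.
by rewrite mulr1 mulrC.
Qed.

(** * Solving the triangular system *)

Theorem mainTheorem7 (R : realType) (N : nat)
    (K : nat -> nat -> 'M[R]_N) (Xi X : nat -> 'cV[R]_N)
    (rho : R) (rho_gt0 : 0 < rho)
    (K_cvg : forall t s : R, `|t| < rho -> `|s| < rho -> powser2_abs_cvg K t s)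
    (Xi_cvg : forall t : R, `|t| < rho -> powser_abs_cvg Xi t)
    (X_cvg : forall t : R, `|t| < rho -> powser_abs_cvg X t)
    (j0 : nat)
    (bK_eq0 : forall n j : nat, (j < j0)%N -> (j <= n)%N -> bK K n j = 0)
    (bK_unit : forall n : nat, (j0 <= n)%N -> bK K n j0 \in unitmx)
    (volterra : exists2 delta : R, 0 < delta &
      forall t : R, 0 <= t -> t < delta ->
        powser Xi t + vint (fun s => powser2 K t s *m powser X s) t = 0) :
  [/\ Xi 0%N = 0,
      forall n : nat, (n < j0)%N -> Xi n.+1 = 0 &
      forall n : nat, (j0 <= n)%N ->
        X (n - j0)%N =
        - (invmx (bK K n j0) *m
           (Xi n.+1 + \sum_(j0.+1 <= j < n.+1) bK K n j *m X (n - j)%N))].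
Proof.
have [Xi0 E] := volterra_coef rho_gt0 K_cvg Xi_cvg X_cvg volterra.
(* Terms with [m < j0] vanish, so the sum may start at any [k <= j0]. For [n < j0] the choice
   [k = n.+1] empties it; for [n >= j0] the choice [k = j0] puts the invertible term first. *)
have E' n k : (k <= j0)%N -> (k <= n.+1)%N ->
    Xi n.+1 + \sum_(k <= m < n.+1) bK K n m *m X (n - m)%N = 0.
  move=> kj kn; rewrite -[RHS](E n) (@big_cat_nat _ _ _ k 0)//=; congr (_ + _).
  rewrite [X in _ = X + _]big_nat_cond [X in _ = X + _]big1 ?add0r// => m /andP[/andP[_ mk] _].
  by rewrite bK_eq0 ?mul0mx//; lia.
split=> // n nj.
  by have := E' n n.+1 nj (leqnn _); rewrite big_geq// addr0.
have := E' n j0 (leqnn _) (leqW nj); rewrite big_ltn// addrCA => /eqP.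
rewrite addr_eq0 => /eqP e; rewrite -mulmxN -e mulKmx//; exact: bK_unit.
Qed.
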